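(* Let $B=\bigcup_{i\ge0}B_i$ be a filtered algebra over an algebraically closed field $K$ of characteristic zero such that the associated graded algebra $\operatorname{gr} B=\bigoplus_{i\ge0}B_i/B_{i-1}$ is a commutative domain, and such that $B$ satisfies the commutative centralizer condition and admits the Dixmier partition. Let $f(t)\in K[t]$ be an arbitrary polynomial of degree $>1$. (1) Let $i\in\{1,2\}$. If $a\in\Delta_i(B)$ then $f(a)\in\Delta_i(B)$, provided $f(a)\notin Z(B)$. (2) Let $i\in\{3,4\}$. If $a\in\Delta_i(B)$ then $f(a)\in\Delta_5(B)$. (3) If $a\in\Delta_5(B)$ then $f(a)\in\Delta_5(B)$.
   Context: Algebras are associative and unital. A filtered $K$-algebra $B=\bigcup_{i\ge0}B_i$ means: $B_0\subseteq B_1\subseteq\cdots$ are $K$-subspaces with $1\in B_0$, $B_iB_j\subseteq B_{i+j}$, and $B_{-1}:=0$. $Z(B)$ is the centre. For $a\in B$ let $\operatorname{ad} a: b\mapsto[a,b]=ab-ba$, and (with $K$ algebraically closed) put $C(a)=\ker(\operatorname{ad} a)$; $N(a)=\bigcup_{i\ge0}\ker\big((\operatorname{ad} a)^{i+1}\big)$; $D(a)=\bigoplus_{\lambda\in K}\{b\in B:[a,b]=\lambda b\}$; $F(a)=\{b\in B:\dim_K K[\operatorname{ad} a]\,b<\infty\}$. Types of elements $a\in B\setminus Z(B)$: $a\in\Delta_1(B)$ (strongly nilpotent) if $N(a)=B$ and $D(a)=C(a)$; $a\in\Delta_2(B)$ (weakly nilpotent) if $C(a)\ne N(a)\ne B$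 and $D(a)=C(a)$; $a\in\Delta_3(B)$ (strongly semi-simple) if $N(a)=C(a)$ and $D(a)=B$; $a\in\Delta_4(B)$ (weakly semi-simple) if $N(a)=C(a)$ and $C(a)\ne D(a)=F(a)\ne B$; $a\in\Delta_5(B)$ (generic) if $N(a)=D(a)=C(a)$. $B$ admits the Dixmier partition if $B\setminus Z(B)=\Delta_1(B)\cup\cdots\cup\Delta_5(B)$. A noncommutative algebra satisfies the commutative centralizer condition if the centralizer of each of its non-central elements is a commutative algebra. *)

(* Defs.v *)
From HB Require Import structures.
From mathcomp Require Import all_boot all_order all_algebra.
From mathcomp Require Import generic_quotient ring_quotient.
From mathcomp Require Import boolp classical_sets.

Set Implicit Arguments.
Unset Strict Implicit.
Unset Printing Implicit Defensive.

Import GRing.Theory.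
Local Open Scope classical_set_scope.
Local Open Scope ring_scope.
Local Open Scope quotient_scope.

Definition subspace (K : fieldType) (V : lmodType K) (S : set V) : Prop :=
  S 0 /\ forall (k : K) (u v : V), S u -> S v -> S (k *: u + v).

Record filtration (K : fieldType) (B : algType K) := Filtration {
  fil :> nat -> set B;
  fil_subspace : forall i, subspace (fil i);
  fil1 : fil 0%N 1;
  fil_incr : forall i, fil i `<=` fil i.+1;
  filM : forall i j u v, fil i u -> fil j v -> fil (i + j)%N (u * v);
  fil_exhaustive : \bigcup_i fil i = setT
}.

Section AssociatedGraded.
Variables (K : fieldType) (B : algType K) (F : filtration B).

(* B_(i-1), with B_(-1) = 0 *)
Definition fil_pred (i : nat) : set B := if i is j.+1 then F j else [set 0].

(* A finitely supported family (b_i)_i with b_i in B_i is encoded as the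
   polynomial \sum_i b_i 'X^i: such polynomials form the Rees subring of
   {poly B}, and gr B is its quotient by the ideal of families with b_i in
   B_(i-1). *)
Definition rees_pred : {pred {poly B}} :=
  fun p => `[< forall i, F i p`_i >].

Lemma filD i u v : F i u -> F i v -> F i (u + v).
Proof. by move=> Fu Fv; rewrite -[u]scale1r; apply: (fil_subspace F i).2. Qed.

Lemma filZ i k u : F i u -> F i (k *: u).
Proof.
move=> Fu; rewrite -[k *: u]addr0.
by apply: (fil_subspace F i).2 => //; apply: (fil_subspace F i).1.
Qed.

Lemma filN i u : F i u -> F i (- u).
Proof. by rewrite -scaleN1r; exact: filZ. Qed.

Lemma fil_sum i (I : Type) (r : seq I) (P : pred I) (f : I -> B) :
  (forall j, P j -> F i (f j)) -> F i (\sum_(j <- r | P j) f j).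
Proof.
move=> Ff; elim/big_ind: _ => //; first exact: (fil_subspace F i).1.
by move=> x y; exact: filD.
Qed.

Lemma fil_pred0 i : fil_pred i 0.
Proof. by case: i => //= i; exact: (fil_subspace F i).1. Qed.

Lemma fil_predB i u v : fil_pred i u -> fil_pred i v -> fil_pred i (u - v).
Proof.
case: i => /= [-> ->|i Fu Fv]; first by rewrite subrr.
by apply: filD => //; exact: filN.
Qed.

Lemma fil_pred_sum i (I : Type) (r : seq I) (P : pred I) (f : I -> B) :
  (forall j, P j -> fil_pred i (f j)) -> fil_pred i (\sum_(j <- r | P j) f j).
Proof.
case: i => /= [f0|i]; last exact: fil_sum.
by rewrite big1.
Qed.

Lemma fil_predMl i j u v : F i u -> fil_pred j v -> fil_pred (i + j) (u * v).
Proof.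
case: j => /= [_ ->|j Fu Fv]; first by rewrite mulr0; exact: fil_pred0.
by rewrite addnS; exact: filM.
Qed.

Lemma fil_predMr i j u v : fil_pred i u -> F j v -> fil_pred (i + j) (u * v).
Proof.
case: i => /= [-> _|i Fu Fv]; first by rewrite mul0r; exact: fil_pred0.
exact: filM.
Qed.

Lemma rees_subring_closed : GRing.subring_closed rees_pred.
Proof.
split.
- apply/asboolP => -[|i]; rewrite coef1 ?eqxx; first exact: fil1.
  exact: (fil_subspace F i.+1).1.
- move=> p q /asboolP Fp /asboolP Fq; apply/asboolP => i.
  by rewrite coefB; apply: filD => //; exact: filN.
- move=> p q /asboolP Fp /asboolP Fq; apply/asboolP => i.
  rewrite coefM; apply: fil_sum => -[j /= ji] _.
  by rewrite -(subnKC (ltnSE ji)) addKn; exact: filM.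
Qed.
HB.instance Definition _ :=
  GRing.isSubringClosed.Build {poly B} rees_pred rees_subring_closed.

Record rees := Rees { rees_val : {poly B}; _ : rees_val \in rees_pred }.
HB.instance Definition _ := [isSub for rees_val].
HB.instance Definition _ := [Choice of rees by <:].
HB.instance Definition _ := [SubChoice_isSubNzRing of rees by <:].

Definition rees_ideal : {pred rees} :=
  fun p => `[< forall i, fil_pred i (rees_val p)`_i >].

Lemma rees_ideal_zmod : zmod_closed rees_ideal.
Proof.
split=> [|p q /asboolP Ip /asboolP Iq]; apply/asboolP => i.
  by rewrite coef0; exact: fil_pred0.
by rewrite coefB; exact: fil_predB.
Qed.
HB.instance Definition _ :=
  GRing.isZmodClosed.Build rees rees_ideal rees_ideal_zmod.

Lemma rees_idealMl p q : q \in rees_ideal -> p * q \in rees_ideal.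
Proof.
case: p => p /= /[dup] /asboolP Fp ? /asboolP Iq; apply/asboolP => i.
rewrite coefM; apply: fil_pred_sum => -[j /= ji] _.
by rewrite -[X in fil_pred X](subnKC (ltnSE ji)); exact: fil_predMl.
Qed.

Lemma rees_idealMr p q : p \in rees_ideal -> p * q \in rees_ideal.
Proof.
case: q => q /= /[dup] /asboolP Fq ? /asboolP Ip; apply/asboolP => i.
rewrite coefM; apply: fil_pred_sum => -[j /= ji] _.
by rewrite -[X in fil_pred X](subnKC (ltnSE ji)); exact: fil_predMr.
Qed.

(* gr B = \bigoplus_i B_i / B_(i-1) *)
Definition gr : Type := Quotient.quot rees_ideal.
HB.instance Definition _ := GRing.Zmodule.on gr.
HB.instance Definition _ := EqQuotient.on gr.

Definition gr_one : gr := \pi_gr 1.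
Definition gr_mul : gr -> gr -> gr := lift_op2 gr *%R.

Lemma gr_eqP (p q : rees) :
  reflect (\pi_gr p = \pi_gr q) (p - q \in rees_ideal).
Proof. by rewrite Quotient.idealrBE; exact: eqP. Qed.

Lemma gr_piM (p q : rees) : \pi_gr (p * q) = gr_mul (\pi_gr p) (\pi_gr q).
Proof.
unlock gr_mul; apply/gr_eqP; set p' := repr _; set q' := repr _.
have -> : p * q - p' * q' = p * (q - q') + (p - p') * q'.
  by rewrite mulrBr mulrBl addrA subrK.
by apply: rpredD; [apply: rees_idealMl | apply: rees_idealMr];
  apply/gr_eqP; rewrite reprK.
Qed.

Lemma gr_piD (p q : rees) : \pi_gr (p + q) = \pi_gr p + \pi_gr q :> gr.
Proof. exact: Quotient.pi_add. Qed.

Lemma gr_mulA : associative gr_mul.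
Proof.
by move=> x y z; rewrite -[x]reprK -[y]reprK -[z]reprK -!gr_piM mulrA.
Qed.

Lemma gr_mul1 : left_id gr_one gr_mul.
Proof. by move=> x; rewrite -[x]reprK -gr_piM mul1r. Qed.

Lemma gr_mulr1 : right_id gr_one gr_mul.
Proof. by move=> x; rewrite -[x]reprK -gr_piM mulr1. Qed.

Lemma gr_mulDl : left_distributive gr_mul +%R.
Proof.
move=> x y z; rewrite -[x]reprK -[y]reprK -[z]reprK.
by rewrite -gr_piD -!gr_piM mulrDl gr_piD.
Qed.

Lemma gr_mulDr : right_distributive gr_mul +%R.
Proof.
move=> x y z; rewrite -[x]reprK -[y]reprK -[z]reprK.
by rewrite -gr_piD -!gr_piM mulrDr gr_piD.
Qed.

HB.instance Definition _ := GRing.Zmodule_isPzRing.Build gr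
  gr_mulA gr_mul1 gr_mulr1 gr_mulDl gr_mulDr.

End AssociatedGraded.

Definition commutative_domain (R : pzRingType) : Prop :=
  [/\ (1 : R) <> 0, commutative (@GRing.mul R)
    & forall x y : R, x * y = 0 -> x = 0 \/ y = 0].

Section Dixmier.
Variables (K : closedFieldType) (B : algType K).
Implicit Types (a b : B).

Definition alg_center : set B := [set z | forall b, z * b = b * z].

Definition ad a : B -> B := fun b => a * b - b * a.

Definition ad_C a : set B := [set b | ad a b = 0].

Definition ad_N a : set B := \bigcup_i [set b | iter i.+1 (ad a) b = 0].

Definition ad_eigenspace a (l : K) : set B := [set b | ad a b = l *: b].

(* The sum of the eigenspaces over all l : K. It is automatically direct. *)
Definition ad_D a : set B :=
  [set b | exists (s : seq K) (v : K -> B),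
     (forall l, ad_eigenspace a l (v l)) /\ b = \sum_(l <- s) v l].

Definition finite_dimensional (S : set B) : Prop :=
  exists (n : nat) (e : 'I_n -> B),
    S = [set \sum_(i < n) c i *: e i | c in [set: 'I_n -> K]].

(* K[ad a] b = {p(ad a) b | p : {poly K}} *)
Definition ad_cyclic a b : set B :=
  [set \sum_(i < size p) p`_i *: iter i (ad a) b | p in [set: {poly K}]].

Definition ad_F a : set B := [set b | finite_dimensional (ad_cyclic a b)].

Definition Delta1 : set B :=
  [set a | [/\ ~ alg_center a, ad_N a = setT & ad_D a = ad_C a]].

Definition Delta2 : set B :=
  [set a | [/\ ~ alg_center a, ad_C a <> ad_N a, ad_N a <> setT
             & ad_D a = ad_C a]].

Definition Delta3 : set B :=
  [set a | [/\ ~ alg_center a, ad_N a = ad_C a & ad_D a = setT]].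

Definition Delta4 : set B :=
  [set a | [/\ ~ alg_center a, ad_N a = ad_C a
             & [/\ ad_C a <> ad_D a, ad_D a = ad_F a & ad_F a <> setT]]].

Definition Delta5 : set B :=
  [set a | [/\ ~ alg_center a, ad_N a = ad_D a & ad_D a = ad_C a]].

Definition Dixmier_partition : Prop :=
  ~` alg_center = Delta1 `|` Delta2 `|` Delta3 `|` Delta4 `|` Delta5.

Definition commutative_centralizer_condition : Prop :=
  (exists x y : B, x * y <> y * x) /\
  forall a, ~ alg_center a ->
    forall b c, ad_C a b -> ad_C a c -> b * c = c * b.

End Dixmier.

(* Main.v *)
Require Import Defs.
From mathcomp Require Import all_boot all_order all_algebra.
From mathcomp Require Import generic_quotient ring_quotient.
From mathcomp Require Import boolp classical_sets.

(** The theorem is a degree count. Write [d] for the degree of [a] with respect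
to the filtration, [delta] for [ad a] and [n] for the degree of [f]. Since
[gr B] is a commutative domain, degrees add up in products and drop in
commutators; and since [K] is algebraically closed, a polynomial of degree [m]
evaluated at a non-scalar [a] is a product of factors [a - r], each of degree
[d], so that it has degree exactly [m d] ([has_degree_horner]).

The left and the right multiplication by [a] commute, and [ad (f a)] is the
difference of the values of [f] at these two operators. Hence it factors as
[delta o g = g o delta], where [g] is the difference quotient
[(f(x) - f(y)) / (x - y)] evaluated at them. Modulo lower degree
[x] and [y] may be identified, and [g] becomes the multiplication by [f'(a)],
which is nonzero of degree [(n - 1) d] in characteristic zero. So [g] raises
degrees by exactly [(n - 1) d] ([has_degree_diff_quotient]) and is injective.
For every non-scalar [a] this gives:
- [ker (ad (f a))^i = ker delta^i] for all [i], hence [C(f a) = C(a)] and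
  [N(f a) = N(a)];
- if [n > 1], then [ad (f a)] has no nonzero eigenvalue, so
  [D(f a) = C(f a)]. Indeed [ad (f a) b = l b] with [b] and [l] nonzero forces
  [deg b = (n - 1) d + deg (delta b)], and [delta b] is another eigenvector.
  If [d > 0] this is an infinite descent; if [d = 0] it says that
  [deg (delta b) = deg b], although commutators lower the degree.

Non-central elements are non-scalar, and every type is described by comparing
[N], [D], [C] and [B]: once [D(f a) = C(f a)], the type of [f a] depends only on
how [N(a)] compares with [C(a)] and [B]. *)

Set Implicit Arguments.
Unset Strict Implicit.
Unset Printing Implicit Defensive.

Import GRing.Theory.
Local Open Scope ring_scope.

(** * Degrees in a filtered algebra *)

Section FilteredDegree.
Variables (K : fieldType) (B : algType K) (F : filtration B).
Implicit Types (x y : B) (i j k : nat).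

Lemma fil_le i j x : (i <= j)%N -> F i x -> F j x.
Proof.
move=> /subnKC <- Fx; elim: (j - i)%N => [|k IHk]; first by rewrite addn0.
by rewrite addnS; exact: fil_incr.
Qed.

Lemma fil_exp i x k : F i x -> F (k * i)%N (x ^+ k).
Proof.
move=> Fx; elim: k => [|k IHk]; first exact: fil1.
by rewrite exprS mulSn; exact: filM.
Qed.

Lemma fil_predW i x : fil_pred F i x -> F i x.
Proof.
by case: i => [->|i]; [exact: (fil_subspace F 0).1 | exact: fil_incr].
Qed.

Lemma fil_pred_le i j x : (i <= j)%N -> fil_pred F i x -> fil_pred F j x.
Proof.
case: i j => [|i] [|j] //=; last by rewrite ltnS; exact: fil_le.
by move=> _ ->; exact: (fil_pred0 F j.+1).
Qed.

Lemma fil_pred_lt i j x : (i < j)%N -> F i x -> fil_pred F j x.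
Proof. by case: j => // j; rewrite ltnS; exact: fil_le. Qed.

Lemma fil_predZ i (c : K) x : fil_pred F i x -> fil_pred F i (c *: x).
Proof. by case: i => [/= ->|i]; [rewrite scaler0 | exact: filZ]. Qed.

(** A relation rather than a function, so that [0] simply has no degree. *)
Definition has_degree i x : Prop := F i x /\ ~ fil_pred F i x.

Lemma has_degree_neq0 i x : has_degree i x -> x <> 0.
Proof. by case=> _ nFx x0; apply: nFx; rewrite x0; exact: fil_pred0. Qed.

Lemma has_degree_exists x : x <> 0 -> exists i, has_degree i x.
Proof.
move=> x0; have [i _ Fx]: (\bigcup_i F i)%classic x by rewrite fil_exhaustive.
elim: i Fx => [|i IHi] Fx; first by exists 0%N.
by have [/IHi//|nFx] := pselect (F i x); exists i.+1.
Qed.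

Lemma has_degree_uniq i j x : has_degree i x -> has_degree j x -> i = j.
Proof.
move=> [Fi nFi] [Fj nFj]; case: (ltngtP i j) => // ij.
  by case: nFj; exact: fil_pred_lt Fi.
by case: nFi; exact: fil_pred_lt Fj.
Qed.

Lemma has_degree1 : has_degree 0 1.
Proof. by split; [exact: fil1 | move=> /eqP; rewrite oner_eq0]. Qed.

Lemma has_degreeZ i (c : K) x :
  c != 0 -> has_degree i x -> has_degree i (c *: x).
Proof.
move=> c0 [Fx nFx]; split; first exact: filZ.
by move=> /(fil_predZ c^-1); rewrite scalerA mulVf // scale1r.
Qed.

Lemma has_degree_lower i x y :
  has_degree i x -> fil_pred F i (y - x) -> has_degree i y.
Proof.
move=> [Fx nFx] yx; split.
  by rewrite -[y](subrK x); apply: filD => //; exact: fil_predW.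
move=> Fy; apply: nFx.
by rewrite -[x](subKr y); exact: fil_predB.
Qed.

Lemma has_degree_subA i (c : K) x :
  (forall r : K, x <> r%:A) -> has_degree i x -> has_degree i (x - c%:A).
Proof.
move=> x_nscal [Fx nFx].
have Fc j : F j c%:A by apply/filZ/(fil_le (leq0n j))/fil1.
split; first by apply: filD => //; exact: filN.
case: i Fx nFx => [|i] Fx nFx /= Fxc.
  (* degree 0 means nonzero, as B_(-1) = 0 *)
  by apply: (x_nscal c); rewrite -[x](subrK c%:A) Fxc add0r.
by apply: nFx; rewrite /= -[x](subrK c%:A); exact: filD.
Qed.

Lemma symbol_in_rees i x : F i x -> x%:P * 'X^i \in rees_pred F.
Proof.
move=> Fx; apply/asboolP => j; rewrite coefCM coefXn.
by case: eqP => [->|_]; rewrite ?mulr1 // mulr0; exact: (fil_subspace F j).1.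
Qed.

(** The class of [x] in the homogeneous component [B_i / B_(i-1)] of [gr B]. *)
Definition symbol i x (Fx : F i x) : gr F :=
  (\pi_(gr F) (Rees (symbol_in_rees Fx)))%qT.

Lemma symbol_eq i x y (Fx : F i x) (Fy : F i y) :
  symbol Fx = symbol Fy <-> fil_pred F i (x - y).
Proof.
split=> [/gr_eqP/asboolP/(_ i) /=|Pxy].
  by rewrite coefB !coefCM coefXn eqxx !mulr1.
apply/gr_eqP; apply/asboolP => j /=; rewrite coefB !coefCM coefXn -mulrBl.
by case: eqP => [->|_]; rewrite ?mulr1 // mulr0; exact: fil_pred0.
Qed.

Lemma symbol_eq0 i x (Fx : F i x) : symbol Fx = 0 <-> fil_pred F i x.
Proof.
have -> : (0 : gr F) = (\pi_(gr F) 0)%qT.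
  by apply: (@addrI _ (\pi_(gr F) 0)%qT); rewrite -gr_piD !addr0.
split=> [/gr_eqP|Px].
  rewrite subr0 => /asboolP/(_ i) /=.
  by rewrite coefCM coefXn eqxx mulr1.
apply/gr_eqP; rewrite subr0; apply/asboolP => j /=; rewrite coefCM coefXn.
by case: eqP => [->|_]; rewrite ?mulr1 // mulr0; exact: fil_pred0.
Qed.

(** The index [k] is kept apart from [i + j] so that [x * y] and [y * x] can be
given the same degree. *)
Lemma symbolM i j k x y (Fx : F i x) (Fy : F j y) (Fxy : F k (x * y)) :
  k = (i + j)%N -> symbol Fx * symbol Fy = symbol Fxy.
Proof.
move=> kE; rewrite /symbol -[LHS]gr_piM; congr (\pi_(gr F) _)%qT.
apply: val_inj => /=; rewrite kE -mulrA (mulrA 'X^i) -commr_polyXn.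
by rewrite -mulrA -exprD mulrA polyCM.
Qed.

Hypothesis grF : commutative_domain (gr F).

Lemma has_degreeM i j x y :
  has_degree i x -> has_degree j y -> has_degree (i + j) (x * y).
Proof.
move=> [Fx nFx] [Fy nFy]; have Fxy := filM Fx Fy; split=> // Pxy.
have [_ _ idom] := grF.
have /idom[/symbol_eq0 //|/symbol_eq0 //] : symbol Fx * symbol Fy = 0.
by rewrite (symbolM Fx Fy Fxy) //; apply/symbol_eq0.
Qed.

Lemma commutator_lower i j x y :
  F i x -> F j y -> fil_pred F (i + j) (x * y - y * x).
Proof.
move=> Fx Fy; have Fxy := filM Fx Fy.
have Fyx : F (i + j)%N (y * x) by rewrite addnC; exact: filM.
have [_ mulC _] := grF; apply/(symbol_eq Fxy Fyx).
by rewrite -(symbolM Fx Fy) // mulC (symbolM Fy Fx Fyx) // addnC.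
Qed.

End FilteredDegree.

(** * Polynomials evaluated at a non-scalar element *)

Lemma size_deriv_pchar0 (R : idomainType) (p : {poly R}) :
  [pchar R] =i pred0 -> size p^`() = (size p).-1.
Proof.
move=> charR0; have [->|p0] := eqVneq p 0; first by rewrite deriv0 size_poly0.
apply/eqP; rewrite eqn_leq -ltnS prednK ?size_poly_gt0 // lt_size_deriv //=.
case sp: (size p) => [|[|n]] //=; rewrite ltnNge; apply/negP => /leq_sizeP.
move/(_ n (leqnn n))/eqP; rewrite coef_deriv -mulr_natr mulf_eq0.
rewrite ((pcharf0P R).1 charR0) orbF => pn0.
by move: p0; rewrite -lead_coef_eq0 lead_coefE sp pn0.
Qed.

Section HornerAlg.
Variables (K : fieldType) (B : algType K).

Lemma horner_alg_sum (a : B) (f : {poly K}) :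
  horner_alg a f = \sum_(k < size f) f`_k *: a ^+ k.
Proof.
rewrite -{1}[f]coefK poly_def linear_sum; apply: eq_bigr => k _.
by rewrite linearZ /= mulr_algl rmorphXn /= horner_algX.
Qed.

Lemma horner_alg_deriv (a : B) (f : {poly K}) :
  horner_alg a f^`() = \sum_(k < size f) f`_k *: (a ^+ k.-1 *+ k).
Proof.
rewrite -{1}[f]coefK poly_def !linear_sum /=; apply: eq_bigr => k _.
rewrite derivZ derivXn linearZ /= mulr_algl.
by rewrite rmorphMn /= rmorphXn /= horner_algX.
Qed.

End HornerAlg.

(** Splitting [p] into linear factors treats at once the case of positive
degree, where the leading term dominates, and the case [d = 0], where the claim
is that a non-scalar element is transcendental over [K]. *)
Lemma has_degree_horner (K : closedFieldType) (B : algType K)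
    (F : filtration B) (grF : commutative_domain (gr F))
    d (a : B) (p : {poly K}) :
  (forall c, a <> c%:A) -> has_degree F d a -> p != 0 ->
  has_degree F ((size p).-1 * d) (horner_alg a p).
Proof.
move=> a_nscal da p0; have [r pE] := closed_field_poly_normal p.
rewrite pE linearZ /= mulr_algl size_scale ?lead_coef_eq0 //.
rewrite size_prod_XsubC /=; apply: has_degreeZ; first by rewrite lead_coef_eq0.
elim: r {pE} => [|z r IHr].
  by rewrite big_nil rmorph1; exact: has_degree1.
rewrite big_cons rmorphM /= mulSn; apply: has_degreeM => //.
by rewrite rmorphB /= horner_algX horner_algC; exact: has_degree_subA.
Qed.

(** * The difference quotient *)

Section DifferenceQuotient.
Variables (K : closedFieldType) (B : algType K).
Implicit Types (a b : B) (f : {poly K}).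

(** The polynomial [(f(x) - f(y)) / (x - y)] in two commuting variables,
evaluated at the left and the right multiplication by [a] and applied to [b];
the inner sum is the quotient of [x^k - y^k]. *)
Definition diff_quotient a f b : B :=
  \sum_(k < size f) f`_k *: \sum_(i < k) a ^+ i * b * a ^+ (k.-1 - i).

Lemma diff_quotient0 a f : diff_quotient a f 0 = 0.
Proof.
rewrite /diff_quotient big1 // => k _.
by rewrite big1 ?scaler0 // => i _; rewrite mulr0 mul0r.
Qed.

Lemma diff_quotient_ad a f b :
  diff_quotient a f (ad a b) = ad a (diff_quotient a f b).
Proof.
rewrite /ad /diff_quotient mulr_sumr mulr_suml -sumrB; apply: eq_bigr => k _.
rewrite -scalerAr -scalerAl -scalerBr mulr_sumr mulr_suml -sumrB.
congr (_ *: _); apply: eq_bigr => i _.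
by rewrite mulrBr mulrBl !mulrA -exprSr exprS -!mulrA -exprSr exprS.
Qed.

Lemma ad_horner a f b : ad (horner_alg a f) b = diff_quotient a f (ad a b).
Proof.
rewrite diff_quotient_ad /ad horner_alg_sum /diff_quotient.
rewrite !mulr_sumr !mulr_suml -!sumrB.
apply: eq_bigr => k _; rewrite -!scalerAr -!scalerAl -!scalerBr.
congr (_ *: _); rewrite mulr_sumr mulr_suml -sumrB.
(* the sum telescopes along the a^i b a^(k - i) *)
pose t i := a ^+ i * b * a ^+ (k - i).
transitivity (t k - t 0%N); first by rewrite /t subnn subn0 !expr0 mulr1 mul1r.
rewrite -telescope_sumr // big_mkord; apply: eq_bigr => -[i /= ik] _.
rewrite /t exprS !mulrA; congr (_ - _); last rewrite -!mulrA -exprSr.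
  by congr (_ * _ ^+ _); case: (k : nat) ik.
by congr (_ * (_ * _ ^+ _)); case: (k : nat) ik => // m im; rewrite subSn.
Qed.

Lemma iter_ad_horner a f b k :
  iter k (ad (horner_alg a f)) b =
  iter k (diff_quotient a f) (iter k (ad a) b).
Proof.
have adg m c : ad a (iter m (diff_quotient a f) c) =
    iter m (diff_quotient a f) (ad a c).
  by elim: m => //= m IHm; rewrite -diff_quotient_ad IHm.
by elim: k => //= k ->; rewrite ad_horner adg.
Qed.

Variable F : filtration B.
Hypothesis charK0 : [pchar K] =i pred0.
Hypothesis grF : commutative_domain (gr F).

(** In [gr B] the symbol of [a] commutes with that of [b], so each of the [k]
terms [a^i b a^(k-1-i)] agrees with [a^(k-1) b] modulo lower degree, and the
difference quotient reduces to the derivative. *)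
Lemma diff_quotient_lower a f b d j :
  F d a -> F j b ->
  fil_pred F ((size f).-2 * d + j)
    (diff_quotient a f b - horner_alg a f^`() * b).
Proof.
move=> Fa Fb; rewrite horner_alg_deriv mulr_suml -sumrB.
apply: fil_pred_sum => k _; rewrite -scalerAl -scalerBr; apply: fil_predZ.
rewrite mulrnAl -[X in _ *+ X]card_ord -sumr_const -sumrB.
apply: fil_pred_sum => i _.
have ik : (i <= k.-1)%N by rewrite -ltnS (ltn_predK (ltn_ord i)).
have kf : (k.-1 <= (size f).-2)%N.
  by rewrite -!subn1 leq_sub2r // subn1 -ltnS (ltn_predK (ltn_ord k)).
rewrite -[in X in _ - X](subnKC ik) exprD -!mulrA -mulrBr.
apply: (@fil_pred_le _ _ _ (i * d + (j + (k.-1 - i) * d))).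
  by rewrite addnCA -mulnDl subnKC // addnC leq_add2r leq_mul2r kf orbT.
apply: fil_predMl; first exact: fil_exp.
by apply: commutator_lower => //; exact: fil_exp.
Qed.

Lemma has_degree_diff_quotient a f b d j :
  (1 < size f)%N -> (forall c, a <> c%:A) ->
  has_degree F d a -> has_degree F j b ->
  has_degree F ((size f).-2 * d + j) (diff_quotient a f b).
Proof.
move=> sf a_nscal da db; have sf' := size_deriv_pchar0 f charK0.
have f'0 : f^`() != 0.
  by rewrite -size_poly_eq0 sf'; case: (size f) sf => [|[]].
apply: has_degree_lower (diff_quotient_lower f da.1 db.1).
rewrite -sf'; exact: has_degreeM (has_degree_horner grF a_nscal da f'0) db.
Qed.

Lemma nonscalar_has_degree a :
  (forall c : K, a <> c%:A) -> exists d, has_degree F d a.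
Proof. by move=> a_nscal; apply: has_degree_exists; rewrite -(scale0r 1). Qed.

Lemma diff_quotient_eq0 a f b :
  (1 < size f)%N -> (forall c, a <> c%:A) ->
  diff_quotient a f b = 0 <-> b = 0.
Proof.
move=> sf a_nscal; split=> [gb0|->]; last exact: diff_quotient0.
have [d da] := nonscalar_has_degree a_nscal.
apply: contrapT => /(has_degree_exists F)[j db].
exact: has_degree_neq0 (has_degree_diff_quotient sf a_nscal da db) gb0.
Qed.

(** * Centralizer, nilpotent part and eigenvectors of a polynomial in [a] *)

Lemma ad_C_horner a f :
  (1 < size f)%N -> (forall c, a <> c%:A) -> ad_C (horner_alg a f) = ad_C a.
Proof.
by move=> sf a_nscal; apply/seteqP; split=> b;
  rewrite /ad_C /= ad_horner diff_quotient_eq0.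
Qed.

Lemma ad_N_horner a f :
  (1 < size f)%N -> (forall c, a <> c%:A) -> ad_N (horner_alg a f) = ad_N a.
Proof.
move=> sf a_nscal; apply: eq_bigcupr => i _; apply/seteqP.
have iterg0 k b : iter k (diff_quotient a f) b = 0 <-> b = 0.
  by elim: k => //= k IHk; rewrite diff_quotient_eq0.
by split=> b; rewrite /= -!iterS iter_ad_horner iterg0.
Qed.

(** Here degree at least 2 of [f] matters: for [f = X], a semi-simple [a]
has such eigenvectors. Write [n], [d], [j], [e] for the
degrees of [f], [a], [b] and [ad a b]; the eigenvalue equation gives
[j = (n - 1) d + e]. For [d > 0]
the eigenvector [ad a b] has smaller degree than [b], and the induction applies;
for [d = 0] the equality [j = e] contradicts [commutator_lower]. *)
Lemma eigenvector_horner_eq0 a f (l : K) b :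
  (2 < size f)%N -> (forall c, a <> c%:A) -> l != 0 ->
  ad (horner_alg a f) b = l *: b -> b = 0.
Proof.
move=> sf a_nscal l0 eigb; have [d da] := nonscalar_has_degree a_nscal.
apply: contrapT => /(has_degree_exists F)[j db].
elim/ltn_ind: j b db eigb => j IHj b db; rewrite ad_horner => eigb.
have db0 : ad a b <> 0.
  move=> adb0; move: eigb; rewrite adb0 diff_quotient0 => /esym/eqP.
  by rewrite scaler_eq0 (negPf l0) => /eqP/(has_degree_neq0 db).
have [e de] := has_degree_exists F db0.
have jE : j = ((size f).-2 * d + e)%N.
  apply: has_degree_uniq (has_degreeZ l0 db) _; rewrite -eigb.
  exact: has_degree_diff_quotient (ltnW sf) a_nscal da de.
case: (posnP d) => [d0|d_gt0]; last first.
  apply: (IHj e _ (ad a b) de).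
    rewrite jE -[ltnLHS]add0n ltn_add2r muln_gt0 d_gt0.
    by case: (size f) sf => [|[|[]]].
  by rewrite ad_horner diff_quotient_ad eigb /ad -scalerAr -scalerAl -scalerBr.
apply: de.2; rewrite (_ : e = d + j)%N; last by rewrite jE d0 muln0.
by apply: (commutator_lower grF); [exact: da.1 | exact: db.1].
Qed.

Lemma ad_D_horner a f :
  (2 < size f)%N -> (forall c, a <> c%:A) ->
  ad_D (horner_alg a f) = ad_C (horner_alg a f).
Proof.
move=> sf a_nscal; apply/seteqP; split=> b.
  move=> [s [v [eigv ->]]]; rewrite /ad_C /=.
  have adv l : ad (horner_alg a f) (v l) = 0.
    have [l0|l0] := eqVneq l 0; first by rewrite eigv l0 scale0r.
    rewrite (eigenvector_horner_eq0 sf a_nscal l0 (eigv l)).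
    by rewrite /ad mulr0 mul0r subrr.
  by rewrite /ad mulr_sumr mulr_suml -sumrB big1 // => l _; exact: adv.
move=> Cb; exists [:: 0], (fun l => if l == 0 then b else 0).
split=> [l|]; last by rewrite big_seq1 eqxx.
rewrite /ad_eigenspace /=; case: eqP => [->|_]; first by rewrite scale0r.
by rewrite /ad mulr0 mul0r subrr scaler0.
Qed.

End DifferenceQuotient.

Theorem theorem4p6 (K : closedFieldType) (B : algType K) (F : filtration B)
    (charK0 : [pchar K] =i pred0)
    (grF : commutative_domain (gr F))
    (cccB : commutative_centralizer_condition B)
    (dixB : Dixmier_partition B)
    (f : {poly K}) (degf : (1 < (size f).-1)%N) :
  [/\ (forall a : B, Delta1 a -> ~ alg_center (horner_alg a f) ->
         Delta1 (horner_alg a f)) /\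
      (forall a : B, Delta2 a -> ~ alg_center (horner_alg a f) ->
         Delta2 (horner_alg a f)),
      (forall a : B, Delta3 a -> Delta5 (horner_alg a f)) /\
      (forall a : B, Delta4 a -> Delta5 (horner_alg a f))
    & forall a : B, Delta5 a -> Delta5 (horner_alg a f)].
Proof.
have sf : (2 < size f)%N by case: (size f) degf.
have nscal (a : B) : ~ alg_center a -> forall c, a <> c%:A.
  by move=> nZa c aE; apply: nZa => b; rewrite aE mulr_algl mulr_algr.
have NE (a : B) (nZa : ~ alg_center a) :=
  ad_N_horner charK0 grF (ltnW sf) (nscal a nZa).
have CE (a : B) (nZa : ~ alg_center a) :=
  ad_C_horner charK0 grF (ltnW sf) (nscal a nZa).
have DE (a : B) (nZa : ~ alg_center a) :=
  ad_D_horner charK0 grF sf (nscal a nZa).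
have D5 (a : B) : ~ alg_center a -> ad_N a = ad_C a -> Delta5 (horner_alg a f).
  move=> nZa NCa; split; rewrite ?DE ?NE ?CE // => Zfa; apply: (nZa) => b.
  (* b centralizes f(a), hence also a *)
  have : ad_C (horner_alg a f) b by rewrite /ad_C /= /ad Zfa subrr.
  by rewrite CE // => /subr0_eq.
split; [split | split |] => a.
- by case=> nZa Na Da nZfa; split; rewrite ?DE ?NE.
- by case=> nZa CNa Na Da nZfa; split; rewrite ?DE ?NE ?CE.
- by case=> nZa Na Da; exact: D5.
- by case=> nZa Na _; exact: D5.
- by case=> nZa Na Da; apply: D5 => //; rewrite Na.
Qed.
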